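(* Let $A\in\mathbb{R}^{m\times d}$, $b\in\mathbb{R}^m$, $c\in\mathbb{R}^d$, and let $P=\{x\in\mathbb{R}^d: Ax=b,\ x\ge 0\}$. Assume that $P$ is bounded and nonempty and that $c^\top x$ is not constant over $P$. Let $\Delta$, $R_1$, $R_H$ be the suboptimality gap, the $\ell_1$ radius and the entropic radius of $P$, for $\eta>0$ let $x^\eta$ be the optimal solution of the entropy-penalized program, and let $F$ be the optimal face of $P$. If $\eta\ge\frac{R_1+R_H}{\Delta}$, then $$d_1(x^\eta,F)\ \le\ 2R_1\exp\Big(-\eta\frac{\Delta}{R_1}+\frac{R_1+R_H}{R_1}\Big).$$ In particular, $$\lim_{\eta\to\infty}\frac{d_1(x^\eta,F)}{\exp(-M\eta)}=0\qquad\text{for any } M<\Delta/R_1.$$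
   Context: For a nonnegative vector $x$, $H(x)=\sum_i x_i\log\frac1{x_i}$ (natural logarithm, with $0\log\frac10=0$; $x$ is not required to sum to $1$). For $\eta>0$, $x^\eta$ denotes the (unique) minimizer of $c^\top x-\eta^{-1}H(x)$ subject to $Ax=b$, where the entropy term implicitly enforces $x\ge 0$; i.e. the minimization is over $x\in P$. Let $V$ be the set of vertices of $P$ and $v^*\in\operatorname{argmin}_{v\in V}c^\top v$. The suboptimality gap is $\Delta=\min\{c^\top(v-v^* ): v\in V,\ c^\top v>c^\top v^*\}$. The $\ell_1$ radius is $R_1=\max_{x\in P}\|x\|_1$. The entropic radius is $R_H=\max_{x,y\in P}\big(H(x)-H(y)\big)$. The optimal face is $F=\operatorname{conv}\{v\in V: c^\top v=\min_{w\in V}c^\top w\}$, and $d_1(x,F)=\min_{y\in F}\|x-y\|_1$. *)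

(* Defs.v *)
From mathcomp Require Import all_boot all_order all_algebra.
From mathcomp Require Import all_classical all_reals all_analysis.

Set Implicit Arguments.
Unset Strict Implicit.
Unset Printing Implicit Defensive.

Import Order.TTheory GRing.Theory Num.Theory.
Import numFieldNormedType.Exports.

Local Open Scope classical_set_scope.
Local Open Scope ring_scope.

(* Vectors of R^d are column vectors.  Every maximum or minimum of real values
   below is written with [sup] or [inf]: for a nonempty bounded polytope it is
   attained, because the polytope and its optimal face are compact and its set
   of vertices is finite. *)

Definition polytope (R : realType) (m d : nat) (A : 'M[R]_(m, d))
    (b : 'cV[R]_m) : set 'cV[R]_d :=
  [set x | A *m x = b /\ forall i, 0 <= x i 0].

Definition cost (R : realType) (d : nat) (c x : 'cV[R]_d) : R :=
  (c^T *m x) 0 0.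

Definition l1norm (R : realType) (d : nat) (x : 'cV[R]_d) : R :=
  \sum_i `|x i 0|.

(* The convention 0 log (1/0) = 0 holds since the factor [x i 0] vanishes. *)
Definition entropy (R : realType) (d : nat) (x : 'cV[R]_d) : R :=
  \sum_i x i 0 * ln (x i 0)^-1.

Definition argmin (R : realType) (T : Type) (f : T -> R) (S : set T) : set T :=
  [set x | S x /\ forall y, S y -> f x <= f y].

(* The vertices of a polyhedron are its extreme points. *)
Definition vertices (R : realType) (d : nat) (P : set 'cV[R]_d) :
    set 'cV[R]_d :=
  [set v | P v /\ forall y z (t : R), P y -> P z -> 0 < t < 1 ->
                    v = t *: y + (1 - t) *: z -> y = v /\ z = v].

Definition conv_hull (R : realType) (d : nat) (S : set 'cV[R]_d) :
    set 'cV[R]_d :=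
  smallest (@convex_set R 'cV[R]_d) S.

(* The value does not depend on which optimal vertex [vstar] is taken. *)
Definition subopt_gap (R : realType) (d : nat) (P : set 'cV[R]_d)
    (c vstar : 'cV[R]_d) : R :=
  inf [set cost c (v - vstar) | v in
        [set v | vertices P v /\ cost c vstar < cost c v]].

Definition l1_radius (R : realType) (d : nat) (P : set 'cV[R]_d) : R :=
  sup [set l1norm x | x in P].

Definition entropic_radius (R : realType) (d : nat) (P : set 'cV[R]_d) : R :=
  sup [set entropy x - entropy y | x in P & y in P].

Definition optimal_face (R : realType) (d : nat) (P : set 'cV[R]_d)
    (c : 'cV[R]_d) : set 'cV[R]_d :=
  conv_hull (argmin (cost c) (vertices P)).

Definition l1_dist (R : realType) (d : nat) (x : 'cV[R]_d)
    (F : set 'cV[R]_d) : R :=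
  inf [set l1norm (x - y) | y in F].

(* For eta > 0 and P convex, compact and nonempty, the set of minimizers is a
   singleton, and the default value 0 is not used. *)
Definition penalized_opt (R : realType) (d : nat) (P : set 'cV[R]_d)
    (c : 'cV[R]_d) (eta : R) : 'cV[R]_d :=
  xget 0 (argmin (fun x => cost c x - eta^-1 * entropy x) P).

(* Main.v *)
Require Import Defs.
From mathcomp Require Import all_boot all_order all_algebra.
From mathcomp Require Import all_classical all_reals all_analysis.
From mathcomp Require Import ring lra.

Set Implicit Arguments.
Unset Strict Implicit.
Unset Printing Implicit Defensive.

Import Order.TTheory GRing.Theory Num.Theory.
Import numFieldNormedType.Exports.

Local Open Scope classical_set_scope.
Local Open Scope ring_scope.

(* Write the penalized optimum as x = (1 - l) f + l g with f in the optimal face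
   and g in P of cost at least Delta above the minimum, which is possible since P
   is the convex hull of its vertices.  As d_1(x, F) <= l |g - f| <= 2 R1 l, it
   suffices to bound l.  Compare x with w = (1 - mu) f + mu g for 0 < mu < l:
   optimality of x and concavity of the entropy give
   eta Delta <= R1 log(1/mu) + RH + R1, and mu is let tend to l.  Using w instead
   of the derivative of the entropy at x avoids one-sided derivatives when l = 1. *)

(** * Convex sets, their joins, and linear costs *)

Lemma convex_setP (R : realType) (d : nat) (S : set 'cV[R]_d) :
  convex_set S <-> forall x y (t : R), S x -> S y -> 0 <= t <= 1 ->
                     S ((1 - t) *: x + t *: y).
Proof.
split=> [cS x y t Sx Sy /andP[t0 t1]|cS x y t].
  have := cS y x (Itv01 t0 t1).
  by rewrite !inE => /(_ Sy Sx); rewrite /conv /= addrC.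
rewrite !inE => Sx Sy; rewrite /conv /= addrC.
by apply: cS => //; apply/andP; split.
Qed.

Lemma convex_conv_hull (R : realType) (d : nat) (S : set 'cV[R]_d) :
  convex_set (conv_hull S).
Proof.
apply/convex_setP => x y t Sx Sy t01 C [cC SC].
by apply: (convex_setP C).1 => //; [apply: Sx|apply: Sy].
Qed.

(** Merges two weighted points of a convex set without asking the weights to sum to 1. The point [w]
    is the normalized combination; when [p + q = 0] both weights vanish and any point serves. *)
Lemma convex_set_cone (R : realType) (d : nat) (S : set 'cV[R]_d) u v (p q : R) :
  convex_set S -> S u -> S v -> 0 <= p -> 0 <= q ->
  exists2 w, S w & p *: u + q *: v = (p + q) *: w.
Proof.
move=> /convex_setP cS Su Sv p0 q0.
have [pq0|pq0] := eqVneq (p + q) 0.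
  have [-> ->] : p = 0 /\ q = 0 by lra.
  by exists u; rewrite // addr0 !scale0r addr0.
exists ((1 - q / (p + q)) *: u + (q / (p + q)) *: v).
  have {}pq0 : 0 < p + q by rewrite lt_neqAle eq_sym pq0 addr_ge0.
  by apply: cS; rewrite // divr_ge0 ?addr_ge0//= ler_pdivrMr// mul1r lerDr.
rewrite scalerDr !scalerA mulrBr mulr1 [_ * (q / _)]mulrC divfK//.
by congr (_ *: _ + _); lra.
Qed.

(** A combination of two points of the join has four terms; grouping the two from [F] and the two
    from [G] with [convex_set_cone] leaves one point of each. *)
Lemma convex_set_join (R : realType) (d : nat) (F G : set 'cV[R]_d) :
  convex_set F -> convex_set G ->
  convex_set [set x | exists f g (l : R),
    [/\ F f, G g, 0 <= l <= 1 & x = (1 - l) *: f + l *: g]].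
Proof.
move=> cF cG; apply/convex_setP => _ _ t [f1 [g1 [a [Ff1 Gg1 /andP[a0 a1] ->]]]]
  [f2 [g2 [b [Ff2 Gg2 /andP[b0 b1] ->]]]] /andP[t0 t1].
have ta : 0 <= (1 - t) * (1 - a) by nra.
have tb : 0 <= t * (1 - b) by nra.
have ta' : 0 <= (1 - t) * a by nra.
have tb' : 0 <= t * b by nra.
have [f Ff ff] := convex_set_cone cF Ff1 Ff2 ta tb.
have [g Gg gg] := convex_set_cone cG Gg1 Gg2 ta' tb'.
exists f, g, ((1 - t) * a + t * b); split => //; first by apply/andP; split; nra.
rewrite -gg !scalerDr !scalerA addrACA ff; congr (_ *: _ + _); ring.
Qed.

Lemma costD (R : realType) (d : nat) (c x y : 'cV[R]_d) :
  cost c (x + y) = cost c x + cost c y.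
Proof. by rewrite /cost mulmxDr mxE. Qed.

Lemma costZ (R : realType) (d : nat) (c x : 'cV[R]_d) (t : R) :
  cost c (t *: x) = t * cost c x.
Proof. by rewrite /cost -scalemxAr mxE. Qed.

Lemma costB (R : realType) (d : nat) (c x y : 'cV[R]_d) :
  cost c (x - y) = cost c x - cost c y.
Proof. by rewrite costD -scaleN1r costZ mulN1r. Qed.

Lemma convex_polytope (R : realType) (m d : nat) (A : 'M[R]_(m, d))
  (b : 'cV[R]_m) : convex_set (polytope A b).
Proof.
apply/convex_setP => x y t [Ax x0] [Ay y0] /andP[t0 t1]; split => [|i].
  by rewrite mulmxDr -!scalemxAr Ax Ay -scalerDl subrK scale1r.
by rewrite !mxE; have := x0 i; have := y0 i; nra.
Qed.

Lemma bounded_set_coord (R : realType) (d : nat) (P : set 'cV[R]_d) :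
  bounded_set P -> exists2 K : R, 0 < K & forall x i, P x -> `|x i 0| <= K.
Proof.
(* Boundedness speaks only of reals strictly above [M]; this choice is above [M] and positive as
   well. *)
move=> [M [_ PM]]; exists (Num.max M 0 + 1).
  by rewrite ltr_wpDl// le_max lexx orbT.
move=> x i Px; have /PM/(_ _ Px) : M < Num.max M 0 + 1.
  by rewrite ltr_pwDr// le_max lexx.
apply: le_trans; rewrite /Num.norm /= mx_normrE; apply/bigmax_geP; right => /=.
by exists (i, 0).
Qed.

(** * A bounded polytope is the convex hull of its vertices *)

Section vertices_hull.
Variables (R : realType) (m d : nat) (A : 'M[R]_(m, d)) (b : 'cV[R]_m).
Let P := polytope A b.

Let supp (x : 'cV[R]_d) := [set i | x i 0 != 0]%SET.

(** Move from [x] along [w] until a first coordinate reaches 0. Since [w] vanishes wherever [x]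
    does, no coordinate becomes newly nonzero, and every coordinate that decreases starts positive,
    so the step is positive. *)
Lemma polytope_shrink_supp (x w : 'cV[R]_d) : bounded_set P -> P x -> w != 0 ->
  A *m w = 0 -> (supp w \subset supp x)%SET ->
  exists s : R, [/\ 0 < s, P (x + s *: w) & (supp (x + s *: w) \proper supp x)%SET].
Proof.
move=> /bounded_set_coord[K K0 PK] [Ax x0] w0 Aw wx.
(* Otherwise the ray from [x] along [w] would stay in [P]. *)
have [i0 wi0] : exists i, w i 0 < 0.
  apply: contrapT => /forallNP wp.
  have {}wp i : 0 <= w i 0 by rewrite leNgt; apply/negP/wp.
  have [i wi] : exists i, 0 < w i 0.
    apply: contrapT => /forallNP wn; case/eqP: w0; apply/colP => i.
    by rewrite mxE; apply/eqP; rewrite eq_le wp andbT leNgt; apply/negP/wn.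
  (* This step length brings coordinate [i] to [x i 0 + K + 1], above the bound [K]. *)
  have : P (x + ((K + 1) / w i 0) *: w).
    split=> [|j]; first by rewrite mulmxDr -scalemxAr Aw scaler0 addr0.
    by rewrite !mxE addr_ge0// mulr_ge0// divr_ge0 ?addr_ge0// ltW.
  move=> /(PK _ i); rewrite !mxE divfK ?gt_eqF//.
  by move=> /(le_trans (ler_norm _)); have := x0 i; lra.
(* For [w i 0 < 0], this is the step at which coordinate [i] vanishes; the smallest such step keeps
   all coordinates nonnegative. *)
pose F i := x i 0 / - w i 0.
have := arg_minP (P := fun i => w i 0 < 0) F wi0.
case=> i wi iF.
have xi : 0 < x i 0.
  have := fintype.subsetP wx i; rewrite !inE lt_eqF// => /(_ isT).
  by rewrite lt_neqAle eq_sym x0 andbT.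
have xwi : (x + F i *: w) i 0 = 0.
  by rewrite !mxE /F invrN mulrN mulNr divfK ?lt_eqF// subrr.
exists (F i); split.
- by rewrite divr_gt0// oppr_gt0.
- split=> [|j]; first by rewrite mulmxDr -scalemxAr Aw scaler0 addr0.
  rewrite !mxE; have [wj|wj] := ltP (w j 0) 0.
    have := iF _ wj; rewrite {2}/F ler_pdivlMr ?oppr_gt0//; lra.
  by rewrite addr_ge0// mulr_ge0// divr_ge0 ?oppr_ge0// ltW.
- apply/properP; split; last by exists i; rewrite !inE ?xwi ?eqxx// gt_eqF.
  apply/fintype.subsetP => j; rewrite !inE !mxE; apply: contraNN => /eqP xj.
  have /implyP := fintype.subsetP wx j; rewrite !inE xj eqxx.
  by rewrite implybF negbK => /eqP->; rewrite mulr0 addr0.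
Qed.

(** Strong induction on the size of the support. A point [x] that is not a vertex lies strictly
    between distinct [y] and [z] in [P]. Where [x] vanishes so do [y] and [z], by nonnegativity, so
    the support can be shrunk along both [y - z] and its opposite, and [x] lies between the two
    points reached. *)
Lemma polytope_sub_conv_hull : bounded_set P -> P `<=` conv_hull (vertices P).
Proof.
move=> bP x Px C [/convex_setP cC VC].
have [n] := ubnP #|supp x|; elim: n x Px => // n IH x Px xn.
have [/VC//|] := pselect (vertices P x).
apply: contra_notP => nCx; split=> // y z t Py Pz /andP[t0 t1] xyz.
suff yz : y = z by move: xyz; rewrite yz -scalerDl subrKC scale1r.
apply: contra_notP nCx => yz.
pose w := y - z.
have w0 : w != 0 by rewrite subr_eq0; apply/eqP.
have Aw : A *m w = 0 by rewrite mulmxBr Py.1 Pz.1 subrr.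
have wx : (supp w \subset supp x)%SET.
  apply/fintype.subsetP => i; rewrite !inE; apply: contraNN => /eqP.
  have := Py.2 i; have := Pz.2 i; rewrite xyz !mxE => z0 y0 xi.
  have [-> ->] : y i 0 = 0 /\ z i 0 = 0 by split; nra.
  by rewrite subrr.
have [s [s0 Ps sx]] := polytope_shrink_supp bP Px w0 Aw wx.
have [|||s' [s'0 Ps' s'x]] := @polytope_shrink_supp x (- w) bP Px.
- by rewrite oppr_eq0.
- by rewrite mulmxN Aw oppr0.
- apply: fintype.subset_trans wx; apply/fintype.subsetP => i.
  by rewrite !inE mxE oppr_eq0.
have Cs := IH _ Ps (leq_trans (proper_card sx) xn).
have Cs' := IH _ Ps' (leq_trans (proper_card s'x) xn).
have ss' : 0 < s + s' by rewrite addr_gt0.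
(* With this weight the displacements [s *: w] and [s' *: - w] cancel. *)
have := cC _ _ (s / (s + s')) Cs Cs'.
have -> : (1 - s / (s + s')) *: (x + s *: w) + (s / (s + s')) *: (x + s' *: - w) = x.
  by apply/colP => i; rewrite !mxE; field; rewrite gt_eqF.
by apply; rewrite divr_ge0 ?(ltW s0) ?(ltW ss')//= ler_pdivrMr// mul1r lerDl ltW.
Qed.

End vertices_hull.

(** * Concavity and continuity of the entropy *)

(** The right-hand side is the tangent at [w] of the concave function [t * ln t^-1]. For [u > 0] the
    bound is [ln (w / u) <= w / u - 1] multiplied by [u]. *)
Lemma xlnV_le_tangent (R : realType) (u w : R) : 0 <= u -> 0 < w ->
  u * ln u^-1 <= u * ln w^-1 + w - u.
Proof.
rewrite le_eqVlt => /predU1P[<-|u0] w0; first by rewrite !mul0r add0r subr0 ltW.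
have := @le_ln1Dx R (w / u - 1); rewrite subrKC -subr_gt0 opprK subrK divr_gt0//.
move=> /(_ isT); rewrite lnM ?posrE ?invr_gt0// lnV ?posrE// => h.
have := ler_wpM2l (ltW u0) h.
rewrite [u * (w / u - 1)]mulrBr mulrCA divff ?gt_eqF// !mulr1 lnV ?posrE//.
lra.
Qed.

(** On negative reals the function is constantly 0, because [ln] is 0 there. At 0 it is squeezed
    below [2 * Num.sqrt y]: with [s = Num.sqrt y], apply [ln s^-1 <= s^-1] to
    [2 * s * s * ln s^-1]. *)
Lemma continuous_xlnV (R : realType) : continuous (fun x : R => x * ln x^-1).
Proof.
move=> x; have [x0|x0|->] := ltgtP x 0.
- apply: (@near_cst_continuous _ _ (x * ln x^-1) (fun y : R => y * ln y^-1) x).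
  near=> y; rewrite !ln0 ?invr_le0 ?mulr0// ltW//.
  by near: y; exact: lt_nbhsl.
- apply: cvgM; first exact: cvg_id.
  apply: continuous_comp; first by apply: inv_continuous; rewrite gt_eqF.
  by apply: continuous_ln; rewrite invr_gt0.
rewrite /continuous_at mul0r.
apply: (@squeeze_cvgr _ _ _ _ (cst 0) (fun y => 2 * Num.sqrt y)).
- near=> y; have [y0|y0] := leP y 0.
    by rewrite ler0_sqrtr// ln0 ?invr_le0// !mulr0 lexx.
  have y1 : y < 1 by near: y; exact: lt_nbhsl.
  apply/andP; split.
    by rewrite mulr_ge0 ?(ltW y0)// ln_ge0// invf_ge1// ltW.
  have := sqr_sqrtr (ltW y0); have : 0 < Num.sqrt y by rewrite sqrtr_gt0.
  move: (Num.sqrt y) => s s0 <-; have : ln s^-1 <= s^-1.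
    by rewrite ltW// ln_sublinear// invr_gt0.
  rewrite expr2 invfM lnM ?posrE ?invr_gt0//.
  move=> /(ler_wpM2l (ltW (mulr_gt0 s0 s0))); rewrite mulfK ?gt_eqF//; lra.
- exact: cvg_cst.
- have := @sqrt_continuous R 0; rewrite /continuous_at sqrtr0 => h.
  by rewrite -[X in _ --> X](mulr0 2); apply: cvgM h; exact: cvg_cst.
Unshelve. all: by end_near. Qed.

(** The tangent at [w] bounds the increment by [(l - mu) * (y - x) * (ln w^-1 - 1)]. There
    [y * ln w^-1] is controlled by [w >= mu * y], whence the term [ln mu^-1], and [- x * ln w^-1] by
    the same tangent evaluated at [x]. *)
Lemma xlnV_secant (R : realType) (x y w z l mu : R) : 0 <= x -> 0 <= y ->
  0 < mu < l -> l <= 1 -> w = (1 - mu) * x + mu * y -> z = (1 - l) * x + l * y ->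
  z * ln z^-1 - w * ln w^-1 <=
    (l - mu) * (y * ln mu^-1 + y * ln y^-1 - x * ln x^-1 + w - y).
Proof.
move=> x0 y0 /andP[mu0 mul] l1 wE zE.
have mu1 : mu < 1 by apply: lt_le_trans l1.
have z0 : 0 <= z by rewrite zE addr_ge0// mulr_ge0//; lra.
have [w0|w0] := ltP 0 w; last first.
  have [x00 y00] : x = 0 /\ y = 0 by split; nra.
  by rewrite zE wE x00 y00 !(mulr0, mul0r, addr0, subr0).
have zw := xlnV_le_tangent z0 w0; have xw := xlnV_le_tangent x0 w0.
have yw : y * ln w^-1 <= y * ln mu^-1 + y * ln y^-1.
  move: y0; rewrite le_eqVlt => /predU1P[<-|y0]; first by rewrite !mul0r addr0.
  rewrite -mulrDr -lnM ?posrE ?invr_gt0// ler_wpM2l ?(ltW y0)//.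
  rewrite ler_ln ?posrE ?mulr_gt0 ?invr_gt0// -invfM lef_pV2 ?posrE ?mulr_gt0//.
  by rewrite wE lerDr mulr_ge0//; lra.
have -> : z * ln z^-1 - w * ln w^-1 = z * ln z^-1 - (z * ln w^-1 + w - z) +
    (l - mu) * (y - x) * (ln w^-1 - 1).
  by rewrite zE wE; ring.
have lm : 0 < l - mu by rewrite subr_gt0.
nra.
Qed.

Lemma entropy_secant (R : realType) (d : nat) (x y w z : 'cV[R]_d) (l mu : R) :
  (forall i, 0 <= x i 0) -> (forall i, 0 <= y i 0) -> 0 < mu < l -> l <= 1 ->
  w = (1 - mu) *: x + mu *: y -> z = (1 - l) *: x + l *: y ->
  entropy z - entropy w <=
    (l - mu) * (l1norm y * ln mu^-1 + entropy y - entropy x + l1norm w - l1norm y).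
Proof.
move=> x0 y0 mul l1 wE zE.
rewrite /entropy /l1norm mulr_suml -!(sumrB, big_split) /= mulr_sumr ler_sum// => i _.
have w0 : 0 <= w i 0.
  by rewrite wE !mxE; have := x0 i; have := y0 i; nra.
rewrite !ger0_norm//; apply: xlnV_secant => //.
- by rewrite wE !mxE.
- by rewrite zE !mxE.
Qed.

(** * Estimates by the radii, the gap and the distance *)

Lemma l1norm_le_radius (R : realType) (d : nat) (P : set 'cV[R]_d) x :
  bounded_set P -> P x -> l1norm x <= l1_radius P.
Proof.
move=> /bounded_set_coord[K _ PK] Px; apply: ub_le_sup; last by exists x.
by exists (\sum_(i < d) K) => _ [y Py <-]; apply: ler_sum => i _; exact: PK.
Qed.

Lemma entropyB_le_radius (R : realType) (d : nat) (P : set 'cV[R]_d) x y :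
  bounded_set P -> (forall x, P x -> forall i, 0 <= x i 0) -> P x -> P y ->
  entropy x - entropy y <= entropic_radius P.
Proof.
move=> /bounded_set_coord[K K0 PK] P0 Px Py; apply: ub_le_sup; last first.
  by exists x => //; exists y.
(* Per coordinate, the tangent at 1 gives [t * ln t^-1 <= 1], and [ln t < t] gives
   [t * ln t <= K * K]. *)
exists (\sum_(i < d) (1 + K * K)) => _ [{Px}x Px] [{Py}y Py] <-.
rewrite /entropy -sumrB; apply: ler_sum => i _; apply: lerD.
  have := xlnV_le_tangent (P0 _ Px i) ltr01; rewrite invr1 ln1 mulr0 add0r.
  by have := P0 _ Px i; lra.
have := PK y i Py; have := P0 _ Py i; move: (y i 0) => t.
rewrite le_eqVlt => /predU1P[<- _|t0]; first by rewrite mul0r oppr0 mulr_ge0// ltW.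
rewrite gtr0_norm// => tK; rewrite lnV ?posrE// mulrN opprK.
have := ler_wpM2l (ltW t0) (ltW (ln_sublinear t0)); nra.
Qed.

Lemma subopt_gap_le (R : realType) (d : nat) (P : set 'cV[R]_d) (c vstar v : 'cV[R]_d) :
  vertices P v -> cost c vstar < cost c v ->
  subopt_gap P c vstar <= cost c v - cost c vstar.
Proof.
move=> Vv vv; rewrite -costB; apply: ge_inf; last by exists v.
by exists 0 => _ [u [_ uv] <-]; rewrite costB subr_ge0 ltW.
Qed.

Lemma l1_dist_le (R : realType) (d : nat) (x y : 'cV[R]_d) (F : set 'cV[R]_d) :
  F y -> l1_dist x F <= l1norm (x - y).
Proof.
move=> Fy; apply: ge_inf; last by exists y.
by exists 0 => _ [u _ <-]; apply: sumr_ge0.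
Qed.

Lemma l1_dist_ge0 (R : realType) (d : nat) (x : 'cV[R]_d) (F : set 'cV[R]_d) :
  F !=set0 -> 0 <= l1_dist x F.
Proof.
move=> [y Fy]; apply: lb_le_inf; first by exists (l1norm (x - y)), y.
by move=> _ [u _ <-]; apply: sumr_ge0.
Qed.

Lemma l1normD (R : realType) (d : nat) (x y : 'cV[R]_d) :
  l1norm (x + y) <= l1norm x + l1norm y.
Proof.
by rewrite /l1norm -big_split; apply: ler_sum => i _; rewrite mxE ler_normD.
Qed.

Lemma l1normZ (R : realType) (d : nat) (x : 'cV[R]_d) (t : R) :
  l1norm (t *: x) = `|t| * l1norm x.
Proof. by rewrite /l1norm mulr_sumr; apply: eq_bigr => i _; rewrite mxE normrM. Qed.

(** * Existence of the penalized optimum *)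

Lemma continuous_sum (R : realType) (T : topologicalType) (n : nat)
  (f : 'I_n -> T -> R) : (forall i, continuous (f i)) ->
  continuous (fun x => \sum_i f i x).
Proof.
by move=> cf; apply: continuous_big => [|i _]; [exact: add_continuous|exact: cf].
Qed.

(* Transposed because [rV_compact] and [EVT_min_rV] are about row vectors. *)
Lemma compact_polytopeT (R : realType) (m d : nat) (A : 'M[R]_(m, d)) (b : 'cV[R]_m) :
  bounded_set (polytope A b) -> compact [set r : 'rV[R]_d | polytope A b r^T].
Proof.
move=> /bounded_set_coord[K K0 PK].
have cK : compact [set v : 'rV[R]_d | forall i, v ord0 i \in `[0, K]].
  by apply: (@rV_compact _ _ (fun=> `[0, K]%classic)) => _; exact: segment_compact.
apply: subclosed_compact cK _; last first.
  move=> r Pr i; have := PK _ i Pr; have := Pr.2 i.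
  by rewrite mxE in_itv/= => r0; rewrite ger0_norm// => ->; rewrite r0.
have -> : [set r : 'rV[R]_d | polytope A b r^T] =
    (\bigcap_i ((fun r : 'rV[R]_d => \sum_j A i j * r 0 j) @^-1` [set b i 0])) `&`
    (\bigcap_j ((fun r : 'rV[R]_d => r 0 j) @^-1` [set t | 0 <= t])).
  apply/seteqP; split=> r.
    move=> [Ar r0]; split=> [i _|j _] /=; last by have := r0 j; rewrite mxE.
    by rewrite -Ar mxE; apply: eq_bigr => j _; rewrite mxE.
  move=> [Ar r0]; split=> [|j]; last by rewrite mxE; exact: r0.
  apply/colP => i; rewrite -(Ar i I) mxE; apply: eq_bigr => j _; by rewrite mxE.
apply: closedI; apply: closed_bigI => i _.
  apply: preimage_closed; last exact: closed_eq.
  move=> x _; apply: continuous_sum => j {}x.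
  apply: (@continuous_comp _ _ _ (fun r : 'rV[R]_d => r 0 j) ( *%R (A i j))).
    exact: coord_continuous.
  exact: mulrl_continuous.
apply: preimage_closed; last exact: closed_ge.
move=> x _; exact: coord_continuous.
Qed.

(** The objective is a sum of continuous functions [g i] of single coordinates, so it attains its
    minimum on the compact polytope, and [xget] then returns a minimizer. *)
Lemma penalized_opt_argmin (R : realType) (m d : nat) (A : 'M[R]_(m, d)) (b : 'cV[R]_m)
  (c : 'cV[R]_d) (eta : R) :
  bounded_set (polytope A b) -> polytope A b !=set0 ->
  argmin (fun x => cost c x - eta^-1 * entropy x) (polytope A b)
    (penalized_opt (polytope A b) c eta).
Proof.
move=> bP [x0 Px0]; apply: xgetPex.
pose g i (t : R) := c i 0 * t - eta^-1 * (t * ln t^-1).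
have cg i : continuous (g i).
  move=> t; apply: cvgB; first exact: mulrl_continuous.
  apply: (@continuous_comp _ _ _ (fun t : R => t * ln t^-1) ( *%R eta^-1)).
    exact: continuous_xlnV.
  exact: mulrl_continuous.
pose f (r : 'rV[R]_d) := \sum_i g i (r 0 i).
have fE x : cost c x - eta^-1 * entropy x = f x^T.
  rewrite /cost /entropy mxE mulr_sumr -sumrB; apply: eq_bigr => i _.
  by rewrite !mxE.
have cf : continuous f.
  apply: continuous_sum => i r.
  apply: (@continuous_comp _ _ _ (fun r : 'rV[R]_d => r 0 i) (g i)).
    exact: coord_continuous.
  exact: cg.
have PT0 : [set r : 'rV[R]_d | polytope A b r^T] !=set0.
  by exists x0^T; rewrite /= trmxK.
have [r /[!inE] Pr rmin] :=
  EVT_min_rV PT0 (compact_polytopeT bP) (continuous_subspaceT cf).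
exists r^T; split=> // y Py; rewrite !fE trmxK; apply: rmin.
by rewrite inE /= trmxK.
Qed.

(** * Distance from the penalized optimum to the optimal face *)

Section main.
Variables (R : realType) (m d : nat) (A : 'M[R]_(m, d)) (b : 'cV[R]_m).
Variables (c vstar : 'cV[R]_d).
Let P := polytope A b.
Let F := optimal_face P c.
Hypotheses (bP : bounded_set P) (vstarP : argmin (cost c) (vertices P) vstar).

Lemma optimal_face_cost f : F f -> P f /\ cost c f = cost c vstar.
Proof.
suff FS : F `<=` [set f | P f /\ cost c f = cost c vstar] by move=> /FS.
apply: smallest_sub.
  apply/convex_setP => x y t [Px cx] [Py cy] t01; split.
    exact: (convex_setP P).1 (@convex_polytope _ _ _ A b) _ _ _ Px Py t01.
  by rewrite costD !costZ cx cy; ring.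
move=> v [[Pv Vv] vmin]; split=> //; apply/eqP.
by rewrite eq_le vstarP.2// vmin//; exact: vstarP.1.
Qed.

(** Every vertex lies in [F] or in the convex set [G] of points costing at least the gap more than
    [vstar], so the hull of the vertices lies in the join of [F] and [G]. The disjunct [F x] covers
    an empty [G], for which the join is empty. *)
Lemma polytope_face_join x : P x -> F x \/ exists f g (l : R),
  [/\ F f, P g, subopt_gap P c vstar <= cost c g - cost c vstar,
      0 <= l <= 1 & x = (1 - l) *: f + l *: g].
Proof.
move=> Px; pose G := [set g | P g /\ subopt_gap P c vstar <= cost c g - cost c vstar].
have FV v : vertices P v -> F v \/ G v.
  move=> Vv; have [vv|vv] := leP (cost c v) (cost c vstar).
    left; apply: sub_gen_smallest; split=> // y Vy.
    by apply: le_trans vv _; exact: vstarP.2.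
  by right; split; [exact: Vv.1|exact: subopt_gap_le].
have cF : convex_set F by exact: convex_conv_hull.
have Fvstar : F vstar by exact: sub_gen_smallest.
have [[g0 Gg0]|G0] := pselect (G !=set0); last first.
  left; apply: (smallest_sub cF _ (polytope_sub_conv_hull bP Px)) => v Vv.
  by have [//|Gv] := FV _ Vv; case: G0; exists v.
have cG : convex_set G.
  apply/convex_setP => y z t [Py cy] [Pz cz] t01; split.
    exact: (convex_setP P).1 (@convex_polytope _ _ _ A b) _ _ _ Py Pz t01.
  by rewrite costD !costZ; case/andP: t01 => t0 t1; nra.
have [|f [g [l [Ff [Pg gG] l01 xE]]]] :=
    smallest_sub (convex_set_join cF cG) _ (polytope_sub_conv_hull bP Px); last first.
  by right; exists f, g, l.
move=> v /FV[Fv|Gv].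
  exists v, g0, 0; split => //; first by rewrite lexx ler01.
  by rewrite subr0 scale1r scale0r addr0.
exists vstar, v, 1; split => //; first by rewrite lexx ler01.
by rewrite subrr scale1r scale0r add0r.
Qed.

(** Otherwise [P] contains at most the origin, and the cost is constantly 0 on it. *)
Lemma l1_radius_gt0 : ~ (exists k : R, forall x, P x -> cost c x = k) -> 0 < l1_radius P.
Proof.
move=> nc; rewrite ltNge; apply/negP => R0; apply: nc; exists 0 => x Px.
suff -> : x = 0 by rewrite /cost mulmx0 mxE.
have : l1norm x <= 0 by apply: le_trans R0; exact: l1norm_le_radius.
move=> x0; have : l1norm x == 0 by rewrite eq_le x0 sumr_ge0.
rewrite psumr_eq0// => /allP xi; apply/colP => i.
by have := xi i (mem_index_enum i); rewrite mxE normr_eq0 => /eqP.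
Qed.

Let Delta := subopt_gap P c vstar.
Let R1 := l1_radius P.
Let RH := entropic_radius P.

Lemma weight_le f g (l eta : R) : 0 < eta -> 0 < R1 -> F f -> P g ->
  Delta <= cost c g - cost c vstar -> 0 <= l <= 1 ->
  penalized_opt P c eta = (1 - l) *: f + l *: g ->
  l <= expR (- (eta * (Delta / R1)) + (R1 + RH) / R1).
Proof.
move=> eta0 R10 /optimal_face_cost[Pf cf] Pg cg /andP[l0 l1] xE.
set E := expR _; rewrite leNgt; apply/negP => El.
have E0 : 0 < E by exact: expR_gt0.
(* The midpoint replaces a limit: comparing the optimum with [w] at this [mu] will force
   [mu <= E]. *)
pose mu := (E + l) / 2.
have Emu : E < mu by rewrite /mu; lra.
have mul : 0 < mu < l by apply/andP; rewrite /mu; split; lra.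
have mu01 : 0 <= mu <= 1 by apply/andP; split; lra.
have [Px xmin] := penalized_opt_argmin c eta bP (ex_intro _ _ Pf).
pose w := (1 - mu) *: f + mu *: g.
have Pw : P w by exact: (convex_setP P).1 (@convex_polytope _ _ _ A b) _ _ _ Pf Pg mu01.
have := entropy_secant Pf.2 Pg.2 mul l1 (erefl w) xE.
have := xmin _ Pw; rewrite -/P; set x := penalized_opt P c eta => xw secant.
(* The cost difference carries the same factor [l - mu] as the entropy bound, so it can be
   cancelled. *)
have H : cost c x - cost c w = (l - mu) * (cost c g - cost c vstar).
  by rewrite /x xE /w !costD !costZ cf; ring.
have lmu0 : 0 < l - mu by lra.
have lw : l1norm w <= R1 by exact: l1norm_le_radius.
have lg : l1norm g <= R1 by exact: l1norm_le_radius.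
have lg0 : 0 <= l1norm g by exact: sumr_ge0.
have HR : entropy g - entropy f <= RH by apply: entropyB_le_radius => // y [].
have mu0 : 0 < mu by case/andP: mul.
have ln0 : 0 <= ln mu^-1 by rewrite ln_ge0// invf_ge1//; case/andP: mu01.
have {secant} : entropy x - entropy w <= (l - mu) * (R1 * ln mu^-1 + RH + R1).
  apply: le_trans secant _; rewrite ler_pM2l//.
  have := ler_wpM2r ln0 lg; lra.
have {}xw : eta * (cost c x - cost c w) <= entropy x - entropy w.
  have /(ler_wpM2l (ltW eta0)) :
    cost c x - cost c w <= eta^-1 * (entropy x - entropy w) by lra.
  by rewrite mulrA divff ?gt_eqF// mul1r.
move=> /(le_trans xw); rewrite H mulrCA ler_pM2l// lnV ?posrE// => h.
(* The factor of [R1] on the right is the logarithm of [E], so this yields [mu <= E], against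
   [Emu]. *)
have : R1 * ln mu <= R1 * (- (eta * (Delta / R1)) + (R1 + RH) / R1).
  have -> : R1 * (- (eta * (Delta / R1)) + (R1 + RH) / R1) = - (eta * Delta) + R1 + RH.
    by field; rewrite gt_eqF.
  by have := ler_wpM2l (ltW eta0) cg; lra.
rewrite ler_pM2l// -ler_expR lnK ?posrE//.
by move=> /le_lt_trans/(_ Emu); rewrite ltxx.
Qed.

Lemma l1_dist_penalized_le (eta : R) : 0 < eta -> 0 < R1 ->
  l1_dist (penalized_opt P c eta) F <=
    2 * R1 * expR (- (eta * (Delta / R1)) + (R1 + RH) / R1).
Proof.
move=> eta0 R10; have [Px _] := penalized_opt_argmin c eta bP (ex_intro _ _ vstarP.1.1).
have [Fx|[f [g [l [Ff Pg cg l01 xE]]]]] := polytope_face_join Px.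
  apply: le_trans (l1_dist_le _ Fx) _.
  by rewrite subrr -(scale0r 0) l1normZ normr0 mul0r !mulr_ge0 ?expR_ge0 ?ltW.
apply: le_trans (l1_dist_le _ Ff) _.
have -> : penalized_opt (polytope A b) c eta - f = l *: (g - f).
  by rewrite xE; apply/colP => i; rewrite !mxE; ring.
have [Pf _] := optimal_face_cost Ff.
rewrite l1normZ ger0_norm ?(andP l01).1// mulrC ler_pM ?sumr_ge0 ?(andP l01).1//.
  apply: le_trans (l1normD _ _) _; rewrite -scaleN1r l1normZ normrN1 mul1r.
  by rewrite mulr_natl mulr2n lerD ?l1norm_le_radius.
exact: weight_le cg l01 xE.
Qed.

End main.

Theorem corollary1 (R : realType) (m d : nat) (A : 'M[R]_(m, d))
    (b : 'cV[R]_m) (c : 'cV[R]_d) (vstar : 'cV[R]_d) :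
  let P := polytope A b in
  let Delta := subopt_gap P c vstar in
  let R1 := l1_radius P in
  let RH := entropic_radius P in
  let F := optimal_face P c in
  bounded_set P ->
  P !=set0 ->
  ~ (exists k : R, forall x, P x -> cost c x = k) ->
  argmin (cost c) (vertices P) vstar ->
  (forall eta : R, 0 < eta -> (R1 + RH) / Delta <= eta ->
     l1_dist (penalized_opt P c eta) F <=
       2 * R1 * expR (- (eta * (Delta / R1)) + (R1 + RH) / R1)) /\
  (forall M : R, M < Delta / R1 ->
     l1_dist (penalized_opt P c eta) F / expR (- M * eta)
       @[eta --> +oo%R] --> (0 : R)).
Proof.
move=> P Delta R1 RH F bP P0 nc vstarP.
have R10 : 0 < R1 by exact: l1_radius_gt0 nc.
split=> [eta eta0 _|M MD]; first exact: l1_dist_penalized_le.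
(* Dividing the distance bound by [expR (- M * eta)] leaves [C * expR (- (k * eta))], which tends to
   0 because [k > 0]. *)
pose k := Delta / R1 - M.
have k0 : 0 < k by rewrite subr_gt0.
pose C := 2 * R1 * expR ((R1 + RH) / R1).
have lim0 : C * expR (- (k * eta)) @[eta --> +oo%R] --> (0 : R).
  rewrite -[X in _ --> X](mulr0 C); apply: cvgM; first exact: cvg_cst.
  apply: (@cvg_comp _ _ _ ( *%R k) (fun y => expR (- y))); last exact: cvgr_expR.
  by apply: gt0_cvgMry => //; exact: cvg_id.
apply: (squeeze_cvgr _ (cvg_cst 0) lim0); near=> eta.
have eta0 : 0 < eta by near: eta; exact: nbhs_pinfty_gt.
rewrite divr_ge0 ?expR_ge0 ?l1_dist_ge0//=; last first.
  by exists vstar; exact: sub_gen_smallest.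
rewrite ler_pdivrMr ?expR_gt0//.
apply: le_trans (l1_dist_penalized_le bP vstarP eta0 R10) _.
rewrite /C -!mulrA -!expRD ler_pM2l// ler_pM2l// ler_expR /k.
by rewrite -/P -/Delta -/R1 -/RH; lra.
Unshelve. all: by end_near. Qed.
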